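(* Let $D$ be an integral domain with quotient field $K$, and $M$ a maximal ideal of $D$ of finite index such that $\bigcap_{k\ge1}M^k=(0)$ and $D_M$ is analytically irreducible. Let $\hat D$ be the $M$-adic completion of $D$ (an integral domain containing $D$), let $n\ge1$ and $C\in M_n(\hat D)$. Then for every $f\in\mathrm{Int}_K(M_n(D))$ the matrix $f(C)$ lies in $\hat D[C]=\{s(C)\mid s\in\hat D[x]\}$; that is, $\mathrm{Int}_K(M_n(D))(C)\subseteq \hat D[C]$.
   Context: $M_n(R)$ is the ring of $n\times n$ matrices over $R$. $\mathrm{Int}_K(M_n(D))=\{f\in K[x]\mid f(C)\in M_n(D)\text{ for all }C\in M_n(D)\}$. A local domain is analytically irreducible if its completion is a domain. For $f=g/d$ with $g\in D[x]$, $d\in D\setminus\{0\}$, and $C\in M_n(\hat D)$, $f(C)$ is $d^{-1}g(C)$ computed in $M_n(L)$, where $L$ is the quotient field of $\hat D$; $\mathrm{Int}_K(M_n(D))(C)=\{f(C)\mid f\in \mathrm{Int}_K(M_n(D))\}$. *)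

(* Defs.v *)
From HB Require Import structures.
From mathcomp Require Import all_boot all_order all_algebra.
Set Implicit Arguments. Unset Strict Implicit. Unset Printing Implicit Defensive.
Import Order.TTheory GRing.Theory Num.Theory.
Local Open Scope ring_scope.

Definition is_ideal (R : comNzRingType) (I : R -> Prop) : Prop :=
  [/\ I 0, (forall x y, I x -> I y -> I (x + y)) & (forall r x, I x -> I (r * x))].

Definition is_maximal_ideal (R : comNzRingType) (M : R -> Prop) : Prop :=
  [/\ is_ideal M, ~ M 1 &
      (forall J : R -> Prop, is_ideal J -> (forall x, M x -> J x) ->
        J 1 \/ (forall x, J x -> M x))].

Definition finite_index (R : comNzRingType) (I : R -> Prop) : Prop :=
  exists s : seq R, forall x, exists2 y, y \in s & I (x - y).

Fixpoint ideal_pow (R : comNzRingType) (I : R -> Prop) (k : nat) : R -> Prop :=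
  match k with
  | 0 => fun _ => True
  | k'.+1 => fun x => exists s : seq (R * R),
      (forall p, p \in s -> I p.1 /\ ideal_pow I k' p.2) /\
      x = \sum_(p <- s) p.1 * p.2
  end.

(* (Dhat, iota) is the M-adic completion of D, i.e. iota induces a ring
   isomorphism of Dhat onto the inverse limit lim_k D / M^k.  The predicates
   I k are the kernels of the projections Dhat -> D / M^k. *)
Definition is_Madic_completion (D : comNzRingType) (M : D -> Prop)
  (Dhat : comNzRingType) (iota : {rmorphism D -> Dhat}) : Prop :=
  exists I : nat -> Dhat -> Prop,
  [/\ (forall k, is_ideal (I k)),
      (forall k a, I k.+1 a -> I k a),
      (forall k d, I k (iota d) <-> ideal_pow M k d),
      (forall k a, exists d, I k (a - iota d)) &
      ((forall a, (forall k, I k a) -> a = 0) /\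
      (forall u : nat -> D, (forall k, ideal_pow M k (u k.+1 - u k)) ->
        exists a, forall k, I k (a - iota (u k))))].

Definition IntMat (D : idomainType) (n : nat) (f : {poly {fraction D}}) : Prop :=
  forall C : 'M[D]_n.+1, exists B : 'M[D]_n.+1,
    horner_mx (map_mx (@tofrac D) C) f = map_mx (@tofrac D) B.

(* Main.v *)
(** An integer-valued [f = g / d] is uniformly continuous on [M_n(D)] for the [M]-adic topology. Along a line, a polynomial [p] without constant term whose values are all divisible by [d] satisfies: [d] divides [u p_j (x_1 ... x_m)^j] for every [j], where the [x_i] are any [m >= deg p] elements of [M] and [u] is some element of [1 + M] depending on them; hence a perturbation in [M^(m + r)] moves [p / d] by an element of [M^r]. So [f] extends to a map from [M_n(Dhat)] to itself. Applied to the companion matrix of the characteristic polynomial [chi] of [C], this shows that the remainder of [g] modulo [chi], whose coefficients form the first row of [g] at the companion matrix, is [d s] with [s] over [Dhat]; by Cayley-Hamilton [f(C) = s(C)]. *)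

Require Import Defs.
From HB Require Import structures.
From mathcomp Require Import all_boot all_order all_algebra.
From mathcomp Require Import ring.
From Stdlib Require Import ClassicalEpsilon.
Set Implicit Arguments. Unset Strict Implicit. Unset Printing Implicit Defensive.
Import GRing.Theory.
Local Open Scope ring_scope.

(** * Choice of functions and of matrices entry by entry *)

Lemma choice_fun (T U : Type) (P : T -> U -> Prop) :
  (forall x, exists y, P x y) -> exists f, forall x, P x (f x).
Proof.
move=> exP; exists (fun x => sval (constructive_indefinite_description _ (exP x))).
by move=> x; case: constructive_indefinite_description.
Qed.

Lemma choice_mx (R : Type) m n (P : 'I_m -> 'I_n -> R -> Prop) :
  (forall i j, exists x, P i j x) ->
  exists A : 'M[R]_(m, n), forall i j, P i j (A i j).
Proof.
move=> exP; have [f fP] := @choice_fun _ _ (fun ij => P ij.1 ij.2) (fun ij => exP ij.1 ij.2).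
by exists (\matrix_(i, j) f (i, j)) => i j; rewrite mxE; apply: fP (i, j).
Qed.

Lemma horner_mx_MXaddC (R : comNzSemiRingType) n (A : 'M[R]_n.+1) (p : {poly R}) c :
  horner_mx A (p * 'X + c%:P) = horner_mx A p *m A + c%:M.
Proof. by rewrite rmorphD rmorphM /= horner_mx_X horner_mx_C. Qed.

(** * Powers of an ideal, and polynomial values of matrices modulo an ideal *)

Section Ideals.
Variable R : comNzRingType.
Implicit Types (I M : R -> Prop) (x y : R).

Lemma is_ideal_sum I (T : eqType) (s : seq T) (F : T -> R) :
  is_ideal I -> (forall i, i \in s -> I (F i)) -> I (\sum_(i <- s) F i).
Proof.
move=> [I0 ID _] IF; rewrite big_seq.
by elim/big_rec: _ => // i x si Ix; apply: ID => //; apply: IF.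
Qed.

Lemma is_idealN I x : is_ideal I -> I x -> I (- x).
Proof. by move=> [_ _ IM] Ix; rewrite -mulN1r; apply: IM. Qed.

Lemma is_idealB I x y : is_ideal I -> I x -> I y -> I (x - y).
Proof.
by move=> idI Ix Iy; have [_ ID _] := idI; apply: ID => //; apply: is_idealN.
Qed.

Lemma ideal_pow_is_ideal M k : is_ideal M -> is_ideal (ideal_pow M k).
Proof.
move=> [M0 MD MM]; case: k => [|k] //=; split.
- by exists [::]; split=> //; rewrite big_nil.
- move=> x y [s [Ms ->]] [t [Mt ->]]; exists (s ++ t); rewrite big_cat.
  by split=> // p; rewrite mem_cat => /orP[/Ms|/Mt].
- move=> r x [s [Ms ->]]; exists [seq (r * p.1, p.2) | p <- s]; split.
    by move=> _ /mapP[p /Ms[Mp Mp'] ->]; split=> //; apply: MM.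
  by rewrite big_map mulr_sumr; apply: eq_bigr => p _; rewrite mulrA.
Qed.

Lemma ideal_powS_mul M k x y :
  M x -> ideal_pow M k y -> ideal_pow M k.+1 (x * y).
Proof.
move=> Mx My; exists [:: (x, y)]; rewrite big_seq1; split=> // p.
by rewrite inE => /eqP->.
Qed.

Lemma ideal_pow_leq M j k x :
  is_ideal M -> (j <= k)%N -> ideal_pow M k x -> ideal_pow M j x.
Proof.
move=> idM /subnK <-; elim: (k - j)%N x => // i IHi x [s [Ms ->]].
have [_ _ MM] := ideal_pow_is_ideal j idM.
by apply: is_ideal_sum => [|p /Ms[_ /IHi Mp]]; [exact: ideal_pow_is_ideal|exact: MM].
Qed.

(** The power [M^(k + r)] is additively generated by the products [x_1 ... x_k z] with all [x_i] in
    [M] and [z] in [M^r]. Only additivity is asked of [P], because the continuity property of a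
    perturbation is additive but not visibly stable under scaling. *)
Lemma ideal_pow_add_ind M k r (P : R -> Prop) :
  P 0 -> (forall x y, P x -> P y -> P (x + y)) ->
  (forall (s : seq R) z, size s = k -> (forall x, x \in s -> M x) ->
     ideal_pow M r z -> P ((\prod_(x <- s) x) * z)) ->
  forall e, ideal_pow M (k + r) e -> P e.
Proof.
move=> P0 PD; elim: k P P0 PD => [|k IHk] P P0 PD Pprod e.
  by move=> Me; have := Pprod [::] e erefl; rewrite big_nil mul1r; apply.
move=> [s [Ms ->]]; rewrite big_seq.
elim/big_rec: _ => // -[x y] z /Ms[/= Mx My] Pz; apply: (PD) => //.
apply: (IHk (fun y => P (x * y))) My => [|a b Pa Pb|t w st Mt Mw].
- by rewrite mulr0.
- by rewrite mulrDr; apply: PD.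
- have := Pprod (x :: t) w; rewrite big_cons -mulrA /= st; apply=> //.
  by move=> a; rewrite inE => /predU1P[->|/Mt].
Qed.

Lemma ideal_one_add_mul M u v :
  is_ideal M -> M (u - 1) -> M (v - 1) -> M (u * v - 1).
Proof.
move=> [_ MD MM] Mu Mv.
have -> : u * v - 1 = u * (v - 1) + (u - 1).
  by rewrite mulrBr mulr1 addrA subrK.
by apply: MD => //; apply: MM.
Qed.

(** An element of [1 + M] acts invertibly modulo [M^k]: writing [b = u b - (u - 1) b], membership of
    [b] in [M^j] improves to [M^(j + 1)] as long as [j < k]. *)
Lemma ideal_pow_unit_cancel M k u b :
  is_ideal M -> M (u - 1) -> ideal_pow M k (u * b) -> ideal_pow M k b.
Proof.
move=> idM Mu Mub; have : forall j, (j <= k)%N -> ideal_pow M j b; last exact.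
elim=> // j IHj ltjk.
have -> : b = u * b - (u - 1) * b by rewrite mulrBl mul1r opprB addrC subrK.
apply: is_idealB; first exact: ideal_pow_is_ideal.
  exact: ideal_pow_leq ltjk Mub.
by apply: ideal_powS_mul => //; apply/IHj/ltnW.
Qed.

Lemma horner_mx_ideal_congr I n (A B : 'M[R]_n.+1) p :
  is_ideal I -> (forall i j, I (A i j - B i j)) ->
  forall i j, I (horner_mx A p i j - horner_mx B p i j).
Proof.
move=> idI IAB; have [I0 ID IM] := idI; elim/poly_ind: p => [|p c IHp] i j.
  by rewrite !rmorph0 !mxE subrr.
rewrite !horner_mx_MXaddC !mxE [X in _ - X]addrC addrKA -sumrB.
apply: is_ideal_sum => // k _.
set a := horner_mx A p i k; set b := horner_mx B p i k.
have -> : a * A k j - b * B k j = A k j * (a - b) + b * (A k j - B k j).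
  by rewrite !mulrBr [A k j * a]mulrC [A k j * b]mulrC addrA subrK.
by apply: ID; apply: IM; [exact: IHp | exact: IAB].
Qed.

(** Entries of size at most 2 describe a line in matrix space. The bound makes [size g] factors from
    [M] enough for [values_continuous] on every such line. *)
Lemma size_horner_mx_le n (A : 'M[{poly R}]_n.+1) (p : {poly R}) :
  (forall i j, (size (A i j) <= 2)%N) ->
  forall i j, (size (horner_mx A (map_poly polyC p) i j) <= (size p).+1)%N.
Proof.
move=> szA; suff H m (q : {poly R}) : (size q <= m)%N -> forall i j,
    (size (horner_mx A (map_poly polyC q) i j) <= m.+1)%N by exact: H.
elim: m q => [|m IHm] {}p.
  by rewrite leqn0 size_poly_eq0 => /eqP-> i j; rewrite map_poly0 rmorph0 mxE size_poly0.
elim/poly_ind: p => [|p c _] szp i j; first by rewrite map_poly0 rmorph0 mxE size_poly0.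
have {}szp : (size p <= m)%N.
  move: szp; rewrite size_MXaddC; case: ifP => // /andP[/eqP-> _].
  by rewrite size_poly0.
rewrite [map_poly _ _]rmorphD rmorphM /= map_polyX map_polyC /=.
rewrite horner_mx_MXaddC !mxE.
apply: leq_trans (size_polyD _ _) _; rewrite geq_max; apply/andP; split.
  apply: leq_trans (size_sum _ _ _) _; apply/bigmax_leqP => k _.
  apply: leq_trans (size_polyMleq _ _) _.
  have := leq_add (IHm p szp i k) (szA k j); rewrite addn2.
  by case: (_ + _)%N.
case: (i == j); rewrite ?mulr1n ?mulr0n ?size_poly0 //.
exact: leq_trans (size_polyC_leq1 _) _.
Qed.

End Ideals.

(** * Continuity of [g / d] on matrices over [D] *)

Section Continuity.
Variables (D : idomainType) (M : D -> Prop) (d : D).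
Hypotheses (idM : is_ideal M) (d_neq0 : d != 0).

(* [p t |-> p (x t) - x^m p t] kills the coefficient of degree [m] and multiplies the coefficient of degree [j < m] by [x^j] times the local unit [1 - x^(m - j)]. *)
Lemma coef_dvd_of_values (p : {poly D}) (s : seq D) :
  (size p <= (size s).+1)%N -> p`_0 = 0 -> (forall x, x \in s -> M x) ->
  (forall a, exists b, p.[a] = d * b) ->
  exists2 u, M (u - 1) &
    forall j, exists b, u * p`_j * (\prod_(x <- s) x) ^+ j = d * b.
Proof.
elim: s p => [|x s IHs] p szp p0 Ms dp.
  exists 1; first by rewrite subrr; case: idM.
  move=> [|j]; exists 0; first by rewrite p0 mulr0 mul0r mulr0.
  by rewrite nth_default ?mulr0 ?mul0r // (leq_trans szp).
have [M0 MD MM] := idM.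
have Mx : M x by apply: Ms; rewrite mem_head.
pose m := (size s).+1; pose q := \poly_(j < m) ((x ^+ j - x ^+ m) * p`_j).
have [||y sy|a|u Mu du] := IHs q.
- exact: size_poly.
- by rewrite coef_poly p0 mulr0.
- by apply: Ms; rewrite inE sy orbT.
- have [[b1 pb1] [b2 pb2]] := (dp (x * a), dp a).
  exists (b1 - x ^+ m * b2).
  rewrite mulrBr mulrCA -pb1 -pb2 !(horner_coef_wide _ szp).
  rewrite !(big_ord_recr (size s).+1) /= mulrDr exprMn horner_poly.
  rewrite -/m [_ * (x ^+ m * _)]mulrCA [X in _ - X]addrC addrKA mulr_sumr -sumrB.
  apply: eq_bigr => j _; rewrite exprMn !mulrBl.
  by congr (_ - _); rewrite ?mulrA // [p`_j * _]mulrC.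
(* The factor [v] collects the local units of all degrees below [m], so that one multiplier [u * v]
   serves every coefficient. *)
pose v := \prod_(j < m) (1 - x ^+ (m - j)); pose X := \prod_(y <- x :: s) y.
have Muv : M (u * v - 1).
  apply: ideal_one_add_mul => //; rewrite /v.
  elim/big_rec: _ => [|j w _ Mw]; first by rewrite subrr.
  apply: ideal_one_add_mul => //; rewrite addrAC subrr add0r.
  apply: is_idealN => //; rewrite -(prednK (n := m - j)) ?subn_gt0 //.
  by rewrite exprSr; apply: MM.
have dlow j : (j < m)%N -> exists b, u * v * p`_j * X ^+ j = d * b.
  move=> ltjm; have [b qb] := du j.
  exists (b * \prod_(i < m | i != Ordinal ltjm) (1 - x ^+ (m - i))).
  rewrite mulrA -qb coef_poly ltjm /v (bigD1 (Ordinal ltjm)) //= /X big_cons exprMn.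
  have -> : x ^+ m = x ^+ j * x ^+ (m - j) by rewrite -exprD subnKC // ltnW.
  by ring.
exists (u * v) => // j; have [/dlow //|] := ltnP j m.
rewrite leq_eqVlt => /predU1P[<-|ltmj]; last first.
  by exists 0; rewrite nth_default ?mulr0 ?mul0r // (leq_trans szp).
(* In the top degree [m], evaluate [p] at [X]: [d] divides this value and, after scaling by [u * v],
   the sum of the lower terms, hence also the remaining term. *)
have [b pb] := dp X.
have [w Hw] : exists w, \sum_(i < m) u * v * p`_i * X ^+ i = d * w.
  elim/big_rec: _ => [|i y _ [w ->]]; first by exists 0; rewrite mulr0.
  by have [w' ->] := dlow i (ltn_ord i); exists (w' + w); rewrite mulrDr.
exists (u * v * b - w); rewrite mulrBr mulrCA -pb -Hw (horner_coef_wide _ szp).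
rewrite big_ord_recr /= mulrDr mulr_sumr mulrA.
rewrite (eq_bigr (fun i : 'I_m => u * v * p`_i * X ^+ i)) => [|i _]; last by rewrite !mulrA.
by rewrite addrAC subrr add0r.
Qed.

(** Once the constant term is removed, each term of degree [i > 0] at [X * z] is, up to the local
    unit [u], a multiple of [d * z ^+ i], and [z ^+ i] lies in [M^r]. Cancelling [d] and then [u]
    leaves [b] in [M^r]. *)
Lemma values_continuous (p : {poly D}) (s : seq D) r z :
  (size p <= (size s).+1)%N -> (forall x, x \in s -> M x) ->
  ideal_pow M r z -> (forall a, exists b, p.[a] = d * b) ->
  exists2 b, ideal_pow M r b & p.[(\prod_(x <- s) x) * z] - p.[0] = d * b.
Proof.
move=> szp Ms Mz dp; set X := \prod_(x <- s) x.
pose q := p - (p.[0])%:P.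
have szq : (size q <= (size s).+1)%N.
  apply: leq_trans (size_polyD _ _) _; rewrite geq_max szp size_polyN.
  exact: leq_trans (size_polyC_leq1 _) _.
have q0 : q`_0 = 0 by rewrite coefB coefC eqxx horner_coef0 subrr.
have dq a : exists b, q.[a] = d * b.
  have [[b1 pb1] [b2 pb2]] := (dp a, dp 0).
  by exists (b1 - b2); rewrite hornerD hornerN hornerC pb1 pb2 mulrBr.
have [u Mu du] := coef_dvd_of_values szq q0 Ms dq.
have [b qb] := dq (X * z); exists b; last by rewrite -qb hornerD hornerN hornerC.
have idr := ideal_pow_is_ideal r idM; have [Mr0 MrD MrM] := idr.
apply: (ideal_pow_unit_cancel idM Mu).
have [w Mw dw] : exists2 w, ideal_pow M r w & u * q.[X * z] = d * w.
  rewrite horner_coef mulr_sumr.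
  elim/big_rec: _ => [|i y _ [w Mw ->]]; first by exists 0; rewrite ?mulr0.
  have [c Hc] := du i.
  case: (posnP i) => [i0|i_gt0].
    by exists w => //; rewrite i0 q0 mul0r mulr0 add0r.
  exists (c * z ^+ i + w).
    apply: MrD => //; rewrite -(prednK i_gt0) exprSr mulrA; exact: MrM.
  by rewrite mulrDr exprMn !mulrA Hc.
suff -> : u * b = w by [].
by apply: (mulfI d_neq0); rewrite mulrCA -qb.
Qed.

Variables (n : nat) (g : {poly D}).
Hypothesis dg : forall A : 'M[D]_n.+1, exists B, horner_mx A g = d *: B.

Lemma horner_mx_continuous_step r (A E : 'M[D]_n.+1) :
  (forall i j, ideal_pow M (size g + r) (E i j)) ->
  exists2 B : 'M[D]_n.+1, (forall i j, ideal_pow M r (B i j)) &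
    horner_mx (A + E) g - horner_mx A g = d *: B.
Proof.
have idr := ideal_pow_is_ideal r idM; have [Mr0 MrD MrM] := idr.
(* Quantifying over every base point [A] makes [P] additive in [E]: move by [E1], then by [E2] from
   [A + E1]. This reduces [E] to a multiple of one matrix unit. *)
pose P (E : 'M[D]_n.+1) := forall A : 'M[D]_n.+1,
  exists2 B : 'M[D]_n.+1, (forall i j, ideal_pow M r (B i j)) &
    horner_mx (A + E) g - horner_mx A g = d *: B.
have P0 : P 0.
  by move=> A'; exists 0 => [i j|]; rewrite ?mxE // addr0 subrr scaler0.
have PD E1 E2 : P E1 -> P E2 -> P (E1 + E2).
  move=> PE1 PE2 A'; have [B1 MB1 HB1] := PE1 A'.
  have [B2 MB2 HB2] := PE2 (A' + E1).
  exists (B2 + B1) => [i j|]; first by rewrite mxE; apply: MrD.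
  by rewrite scalerDr -HB1 -HB2 addrA addrA subrK.
move=> ME; suff: P E by apply.
rewrite [E]matrix_sum_delta.
elim/big_rec: _ => // i F _ PF; apply: (PD) => //.
elim/big_rec: _ => // j G _ PG; apply: (PD) => //.
apply: (@ideal_pow_add_ind _ M (size g) r (fun e => P (e *: delta_mx i j))) (ME i j).
- by rewrite scale0r.
- by move=> x y Px Py; rewrite scalerDl; apply: (PD).
move=> s z ss Ms Mz A'.
(* [L] is the generic point of the line through [A'] in the direction of the matrix unit. The
   entries of [g] at [L] are one-variable polynomials with values divisible by [d]. *)
pose L : 'M[{poly D}]_n.+1 := map_mx polyC A' + 'X *: map_mx polyC (delta_mx i j).
have szL a b : (size (L a b) <= 2)%N.
  rewrite !mxE; apply: leq_trans (size_polyD _ _) _.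
  rewrite geq_max (leq_trans (size_polyC_leq1 _)) //= mulrC mul_polyC.
  by apply: leq_trans (size_scale_leq _ _) _; rewrite size_polyX.
pose p a b := horner_mx L (map_poly polyC g) a b.
have pE a b x : (p a b).[x] = horner_mx (A' + x *: delta_mx i j) g a b.
  have -> : (p a b).[x] = map_mx (horner_eval x) (horner_mx L (map_poly polyC g)) a b.
    by rewrite mxE.
  rewrite map_horner_mx -map_poly_comp /=; congr (horner_mx _ _ _ _).
    by apply/matrixP => k l; rewrite !mxE /horner_eval !hornerE.
  by apply: map_poly_id => y _; rewrite /= /horner_eval hornerC.
have cont a b : exists c, ideal_pow M r c /\
    (p a b).[(\prod_(x <- s) x) * z] - (p a b).[0] = d * c.
  have [|x|c Mc Hc] := @values_continuous (p a b) s r z _ Ms Mz; last by exists c.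
    by rewrite ss; apply: size_horner_mx_le.
  have [B HB] := dg (A' + x *: delta_mx i j).
  by exists (B a b); rewrite pE HB mxE.
have [B BP] := choice_mx cont.
exists B => [a b|]; first by case: (BP a b).
by apply/matrixP => a b; case: (BP a b) => _; rewrite !pE scale0r addr0 !mxE.
Qed.

Lemma horner_mx_quotient_continuous r (A A' B B' : 'M[D]_n.+1) :
  (forall i j, ideal_pow M (size g + r) (A' i j - A i j)) ->
  horner_mx A g = d *: B -> horner_mx A' g = d *: B' ->
  forall i j, ideal_pow M r (B' i j - B i j).
Proof.
move=> MA HB HB' i j.
have [k l|F MF] := @horner_mx_continuous_step r A (A' - A).
  by rewrite !mxE; apply: MA.
rewrite [A + _]addrC subrK HB HB' -scalerBr => /matrixP/(_ i j).
by rewrite !mxE => /(mulfI d_neq0) ->.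
Qed.

End Continuity.

(** * Passage to the completion *)

(** Approximate [C] by matrices [Ck] over [D]. The quotients of [g(Ck)] by [d] form a Cauchy
    sequence, and its limit [B] satisfies the equation modulo every [I k], hence exactly. *)
Lemma horner_mx_completion (D : idomainType) (M : D -> Prop)
    (Dhat : comNzRingType) (iota : {rmorphism D -> Dhat}) n (g : {poly D}) d :
  is_ideal M -> is_Madic_completion M iota -> d != 0 ->
  (forall A : 'M[D]_n.+1, exists B, horner_mx A g = d *: B) ->
  forall C : 'M[Dhat]_n.+1, exists B,
    horner_mx C (map_poly iota g) = iota d *: B.
Proof.
move=> idM [I [idI decI Iiota densI [sepI limI]]] d_neq0 dg C.
have Ileq j k a : (j <= k)%N -> I k a -> I j a.
  by move/subnK <-; elim: (k - j)%N => // i IHi /decI.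
(* Dividing by [d] costs [size g] levels of precision, so the approximations are shifted by [c]. *)
pose c := size g.
have [Ck CkP] := choice_fun (fun k => choice_mx (fun i j => densI k (C i j))).
have [Bk BkP] := choice_fun (fun k => dg (Ck k)).
have Bk_cauchy i j k : ideal_pow M k (Bk (c + k.+1)%N i j - Bk (c + k)%N i j).
  apply: (horner_mx_quotient_continuous idM d_neq0 dg) (BkP _) (BkP _) i j => i j.
  rewrite -Iiota rmorphB; set a := iota _; set b := iota _.
  have -> : a - b = (C i j - b) - (C i j - a) by ring.
  apply: is_idealB; [exact: idI|exact: CkP|].
  by apply: Ileq (CkP _ i j); rewrite leq_add2l.
have lim i j : exists b, forall k, I k (b - iota (Bk (c + k)%N i j)).
  by apply: limI (fun k => Bk (c + k)%N i j) _.
have [B BP] := choice_mx lim.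
exists B; apply/matrixP => i j; apply/eqP; rewrite -subr_eq0; apply/eqP/sepI => k.
set h := map_poly iota g; set A := map_mx iota (Ck (c + k)%N).
have hA : horner_mx A h i j = iota d * iota (Bk (c + k)%N i j).
  by rewrite -map_horner_mx BkP !mxE rmorphM.
have -> : horner_mx C h i j - (iota d *: B) i j =
    (horner_mx C h i j - horner_mx A h i j) -
    iota d * (B i j - iota (Bk (c + k)%N i j)).
  by rewrite mxE hA; ring.
have [_ _ IM] := idI k.
apply: is_idealB; [exact: idI| |exact: IM].
apply: horner_mx_ideal_congr => // a b; rewrite mxE.
by apply: Ileq (CkP _ a b); rewrite leq_addl.
Qed.

(** * Division by a monic polynomial, read off its companion matrix *)

(** The matrix represents multiplication by ['X] on [R[x]/(h)] in the basis [1, x, ..., x^n], acting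
    on row vectors. The first row of [p(A)] is therefore the class of [p] applied to [1]. *)
Lemma companion_division (R : comNzRingType) n (h : {poly R}) :
  h \is monic -> size h = n.+2 ->
  exists A : 'M[R]_n.+1, forall p, exists q r,
    [/\ p = q * h + r, (size r <= n.+1)%N &
        forall j, horner_mx A p ord0 j = r`_j].
Proof.
move=> /monicP h_monic szh; have hn : h`_n.+1 = 1.
  by move: h_monic; rewrite lead_coefE szh.
exists (\matrix_(k, j) ((j == k.+1 :> nat)%:R - (k == n :> nat)%:R * h`_j)).
elim/poly_ind => [|p c [q [r [-> szr pr]]]].
  exists 0, 0; split; rewrite ?mul0r ?addr0 ?size_poly0 // => j.
  by rewrite rmorph0 mxE coef0.
(* Multiplying the remainder by ['X] may create a term of degree [n + 1] with coefficient [r_n];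
   subtracting [r_n] times the monic [h] removes it. *)
exists (q * 'X + (r`_n)%:P), (r * 'X + c%:P - r`_n *: h); split.
- by rewrite -mul_polyC; ring.
- apply/leq_sizeP => j lenj; rewrite coefB coefD coefMX coefC coefZ.
  case: j lenj => // j; rewrite ltnS addr0 leq_eqVlt => /predU1P[<-|ltnj] /=.
    by rewrite hn mulr1 subrr.
  rewrite (nth_default _ (leq_trans szr ltnj)).
  by rewrite [h`__]nth_default ?szh // mulr0 subr0.
move=> j; rewrite horner_mx_MXaddC !mxE.
rewrite (eq_bigr (fun k : 'I_n.+1 => r`_k * (j == k.+1 :> nat)%:R
    - r`_k * (k == n :> nat)%:R * h`_j)) => [|k _]; last first.
  by rewrite pr mxE mulrBr mulrA.
rewrite sumrB -mulr_suml [X in _ - X * _ + _](bigD1 ord_max) //= eqxx mulr1.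
rewrite [X in _ - (_ + X) * _ + _]big1; last first.
  by move=> k; rewrite -val_eqE /= => /negPf->; rewrite mulr0.
rewrite addr0 coefB coefD coefMX coefC coefZ addrAC; congr (_ + _ - _).
  case: (posnP j) => [->|j_gt0].
    by rewrite big1 // => k _; rewrite mulr0.
  have ltj : (j.-1 < n.+1)%N by rewrite (leq_ltn_trans (leq_pred j)).
  rewrite (bigD1 (Ordinal ltj)) //= prednK // eqxx mulr1 big1 ?addr0 // => k.
  rewrite -val_eqE /= -eqSS prednK // eq_sym => /negPf->.
  by rewrite mulr0.
by rewrite mulrb -val_eqE /= eq_sym.
Qed.

(** * Division of [g] by the characteristic polynomial of [C] *)

Theorem mainTheorem5 (D : idomainType) (M : D -> Prop)
  (hM : is_maximal_ideal M) (hfin : finite_index M)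
  (hsep : forall x, (forall k, (1 <= k)%N -> ideal_pow M k x) -> x = 0)
  (Dhat : idomainType) (iota : {rmorphism D -> Dhat})
  (hcompl : is_Madic_completion M iota)
  (n : nat) (C : 'M[Dhat]_n.+1)
  (f : {poly {fraction D}}) (hf : IntMat n f)
  (g : {poly D}) (d : D) (hd : d != 0)
  (hfg : f = (tofrac d)^-1 *: map_poly (@tofrac D) g) :
  exists s : {poly Dhat},
    (tofrac (iota d))^-1 *:
      horner_mx (map_mx (@tofrac Dhat) C) (map_poly (fun x => tofrac (iota x)) g)
    = horner_mx (map_mx (@tofrac Dhat) C) (map_poly (@tofrac Dhat) s).
Proof.
have [idM _ _] := hM.
(* If [iota d] vanished, [d] would lie in every power of [M], against [hsep]. *)
have iotad_neq0 : iota d != 0.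
  apply: contraNneq hd => iotad0; apply/eqP/hsep => k _.
  have [I [idI _ Iiota _ _]] := hcompl.
  by rewrite -Iiota iotad0; case: (idI k).
have dg (A : 'M[D]_n.+1) : exists B, horner_mx A g = d *: B.
  have [B] := hf A; rewrite hfg linearZ /= -map_horner_mx => HB; exists B.
  have fd_neq0 : tofrac d != 0 by rewrite tofrac_eq0.
  apply/matrixP => i j; apply/eqP; rewrite -tofrac_eq.
  move/matrixP/(_ i j): HB; rewrite !mxE tofracM => <-.
  by rewrite mulVKf.
have [A companionA] := companion_division (char_poly_monic C) (size_char_poly C).
have [B gA] := horner_mx_completion idM hcompl hd dg A.
have [q [r [gqr szr rE]]] := companionA (map_poly iota g).
(* The first row of [g(A) = iota d *: B] is the coefficient vector of the remainder [r], so dividing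
   [r] by [iota d] leaves the first row of [B]. *)
pose s := \poly_(j < n.+1) B ord0 (inord j).
have rs : r = iota d *: s.
  apply/polyP => j; rewrite coefZ coef_poly; case: ltnP => [ltjn|lenj].
    by rewrite -[j in LHS](inordK ltjn) -rE gA mxE.
  by rewrite mulr0 nth_default // (leq_trans szr).
exists s; rewrite (map_poly_comp (@tofrac Dhat) iota) -!map_horner_mx gqr.
rewrite rmorphD rmorphM /= Cayley_Hamilton mulr0 add0r rs linearZ /= map_mxZ.
by rewrite scalerA mulVf ?scale1r // tofrac_eq0.
Qed.
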